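(* Assume that for every $x\in X$ the function $f(x,\cdot)$ and all components of $g(x,\cdot)$ are convex on $Y$. Let $\gamma_1,\gamma_2>0$. Then $\mathcal{G}_{\gamma}(x,y,z)\ge 0$ for every $(x,y,z)\in X\times Y\times\mathbb{R}^p_+$. Furthermore, for $(x,y,z)\in X\times Y\times\mathbb{R}^p_+$, one has $\mathcal{G}_{\gamma}(x,y,z)\le 0$ if and only if $y\in S(x)$ and $z\in\mathcal{M}(x,y)$.
   Context: $X\subseteq\mathbb{R}^n$ and $Y\subseteq\mathbb{R}^m$ are closed convex sets; $f:X\times Y\to\mathbb{R}$ and $g:X\times Y\to\mathbb{R}^p$ are continuously differentiable. $S(x)$ is the set of (global) optimal solutions of the lower-level problem $\min_{y\in Y} f(x,y)$ s.t. $g(x,y)\le 0$. The Lagrangian is $\mathcal{L}(x,y,z):=f(x,y)+z^{T}g(x,y)$, and for $\gamma=(\gamma_1,\gamma_2)$ the doubly regularized gap function is $$\mathcal{G}_{\gamma}(x,y,z):=\max_{\theta\in Y,\ \lambda\in\mathbb{R}^p_+}\Big\{\mathcal{L}(x,y,\lambda)-\tfrac{1}{2\gamma_2}\|\lambda-z\|^2-\mathcal{L}(x,\theta,z)-\tfrac{1}{2\gamma_1}\|\theta-y\|^2\Big\}.$$ The set of multipliers at $(x,y)$ is $$\mathcal{M}(x,y):=\{\lambda\in\mathbb{R}^p_+ : 0\in\nabla_y f(x,y)+\lambda^{T}\nabla_y g(x,y)+\mathcal{N}_Y(y),\ \lambda^{T}g(x,y)=0\},$$ where $\mathcal{N}_Y(y)$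 is the normal cone (of convex analysis) to $Y$ at $y$ and $\lambda^{T}\nabla_y g=\sum_i\lambda_i\nabla_y g_i$. All norms are Euclidean. *)

(* Defs.v *)
From HB Require Import structures.
From mathcomp Require Import all_boot all_order all_algebra.
From mathcomp Require Import all_classical all_reals all_analysis.
Set Implicit Arguments.
Unset Strict Implicit.
Unset Printing Implicit Defensive.
Import Order.TTheory GRing.Theory Num.Theory.
Import numFieldNormedType.Exports.
Local Open Scope classical_set_scope.
Local Open Scope ring_scope.

(* The library norm on ['rV[R]_k] is the sup norm, hence an explicit Euclidean
   structure. *)
Definition dotp (R : realType) (k : nat) (u v : 'rV[R]_k) : R :=
  \sum_(i < k) u 0 i * v 0 i.

Definition enorm (R : realType) (k : nat) (u : 'rV[R]_k) : R :=
  Num.sqrt (dotp u u).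

Definition nonneg_orthant (R : realType) (p : nat) : set 'rV[R]_p :=
  [set l | forall i, 0 <= l 0 i].
Arguments nonneg_orthant {R p}.

(* "F is of class C^1 on A", for a set A that need not be open: F is C^1 on an
   open neighbourhood of A. The values of F far from A are irrelevant.
   In finite dimension, continuity of [q |-> 'd F q v] for each direction v is
   continuity of the derivative in operator norm. *)
Definition C1_on (R : realType) (n m : nat) (W : normedModType R)
    (F : 'rV[R]_n * 'rV[R]_m -> W) (A : set ('rV[R]_n * 'rV[R]_m)) : Prop :=
  exists O : set ('rV[R]_n * 'rV[R]_m),
    [/\ open O, A `<=` O &
        forall q, O q -> differentiable F q /\
          forall v, {for q, continuous (fun q' => 'd F q' v)}].

Definition grad (R : realType) (m : nat) (h : 'rV[R]_m -> R) (y : 'rV[R]_m)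
    : 'rV[R]_m :=
  \row_(j < m) 'D_(delta_mx 0 j) h y.

Definition normal_cone (R : realType) (m : nat) (Y : set 'rV[R]_m)
    (y : 'rV[R]_m) : set 'rV[R]_m :=
  [set v | Y y /\ forall y', Y y' -> dotp v (y' - y) <= 0].

Section LowerLevel.
Variables (R : realType) (n m p : nat).
Variables (Y : set 'rV[R]_m).
Variables (f : 'rV[R]_n -> 'rV[R]_m -> R).
Variables (g : 'rV[R]_n -> 'rV[R]_m -> 'rV[R]_p).
Implicit Types (x : 'rV[R]_n) (y th : 'rV[R]_m) (z l : 'rV[R]_p).

Definition feasible x : set 'rV[R]_m :=
  [set y | Y y /\ forall i, g x y 0 i <= 0].

Definition solutions x : set 'rV[R]_m :=
  [set y | feasible x y /\ forall y', feasible x y' -> f x y <= f x y'].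

Definition lagrangian x y z : R := f x y + dotp z (g x y).

Definition gap_objective (gamma1 gamma2 : R) x y z th l : R :=
  lagrangian x y l - (2 * gamma2)^-1 * enorm (l - z) ^+ 2
  - lagrangian x th z - (2 * gamma1)^-1 * enorm (th - y) ^+ 2.

(* The supremum is taken in the extended reals, so that it has no junk value. *)
Definition gap (gamma1 gamma2 : R) x y z : \bar R :=
  ereal_sup [set (gap_objective gamma1 gamma2 x y z tl.1 tl.2)%:E
            | tl in Y `*` nonneg_orthant].

Definition multipliers x y : set 'rV[R]_p :=
  [set l | [/\ nonneg_orthant l,
      exists2 v, normal_cone Y y v &
        0 = grad (f x) y
            + \sum_(i < p) l 0 i *: grad (fun y' => g x y' 0 i) y + v &
      dotp l (g x y) = 0]].

End LowerLevel.

(* Main.v *)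
(* The objective of the gap function splits into a maximization over
   [lambda >= 0], which is separable across coordinates and solved by
   [l_i = max(0, z_i + gamma2 g_i(x, y))], and a minimization over [theta] in
   [Y] of the Lagrangian plus a proximal term; its minimizer exists because the
   gradient inequality at [y] bounds the sublevel set through [y].
   The point [(y, z)] gives the objective the value [0]. If the maximum is
   nonpositive, the choice [theta = y] makes [z] optimal for the coordinatewise
   problems, i.e. [g <= 0] and [z_i g_i = 0]; the choice [lambda = z] makes [y]
   a fixed point of the proximal step, i.e. [- grad L(y)] is normal to [Y], and
   by convexity [y] then minimizes the Lagrangian over [Y]. Conversely these
   conditions make both parts of the objective nonpositive. *)
Require Import Defs.
From HB Require Import structures.
From mathcomp Require Import all_boot all_order all_algebra.
From mathcomp Require Import ring lra.
From mathcomp Require Import all_classical all_reals all_analysis.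
Set Implicit Arguments.
Unset Strict Implicit.
Unset Printing Implicit Defensive.
Import Order.TTheory GRing.Theory Num.Theory.
Import numFieldNormedType.Exports.
Local Open Scope classical_set_scope.
Local Open Scope ring_scope.

(** * Algebra of the Euclidean inner product *)

Section DotProduct.
Variables (R : realType) (k : nat).
Implicit Types u v w : 'rV[R]_k.

Lemma dotpC u v : dotp u v = dotp v u.
Proof. by apply: eq_bigr => i _; rewrite mulrC. Qed.

Lemma dotpDl u v w : dotp (u + v) w = dotp u w + dotp v w.
Proof. by rewrite -big_split; apply: eq_bigr => i _; rewrite mxE mulrDl. Qed.

Lemma dotpZl (a : R) u v : dotp (a *: u) v = a * dotp u v.
Proof. by rewrite mulr_sumr; apply: eq_bigr => i _; rewrite mxE mulrA. Qed.

Lemma dotpDr u v w : dotp w (u + v) = dotp w u + dotp w v.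
Proof. by rewrite dotpC dotpDl !(dotpC w). Qed.

Lemma dotpZr (a : R) u v : dotp v (a *: u) = a * dotp v u.
Proof. by rewrite dotpC dotpZl dotpC. Qed.

Lemma dotpNl u v : dotp (- u) v = - dotp u v.
Proof. by rewrite -scaleN1r dotpZl mulN1r. Qed.

Lemma dotp0l u : dotp 0 u = 0.
Proof. by rewrite -(scale0r 0) dotpZl mul0r. Qed.

Lemma dotpp_addZ (a : R) u v : dotp (u + a *: v) (u + a *: v) =
  dotp u u + 2 * a * dotp u v + a ^+ 2 * dotp v v.
Proof. by rewrite !(dotpDl, dotpDr, dotpZl, dotpZr) (dotpC v u); ring. Qed.

Lemma dotpp_ge0 u : 0 <= dotp u u.
Proof. by apply: sumr_ge0 => i _; rewrite -expr2 sqr_ge0. Qed.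

Lemma coord_sqr_le_dotpp u i : u 0 i ^+ 2 <= dotp u u.
Proof.
rewrite /dotp (bigD1 i)//= expr2 lerDl; apply: sumr_ge0 => j _.
by rewrite -expr2 sqr_ge0.
Qed.

Lemma enorm_sqr u : enorm u ^+ 2 = dotp u u.
Proof. by rewrite sqr_sqrtr// dotpp_ge0. Qed.

End DotProduct.

(** * First-order convex analysis along segments, and the proximal step *)

Section Segment.
Variables (R : realType) (m : nat) (Y : set 'rV[R]_m).
Implicit Types (h : 'rV[R]_m -> R) (y th : 'rV[R]_m) (t : R).

Lemma convex_set_segment y th t : convex_set Y -> Y y -> Y th ->
  0 <= t <= 1 -> Y (t *: (th - y) + y).
Proof.
move=> cY Yy Yth /andP[t0 t1].
have -> : t *: (th - y) + y = t *: th + (1 - t) *: y.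
  by rewrite scalerBr scalerBl scale1r -addrA [- _ + y]addrC.
by have := cY th y (Itv01 t0 t1); rewrite !inE; exact.
Qed.

Lemma convex_function_segment h y th t : convex_function Y h -> Y y -> Y th ->
  0 <= t <= 1 -> h (t *: (th - y) + y) <= h y + t * (h th - h y).
Proof.
move=> ch Yy Yth /andP[t0 t1].
have -> : t *: (th - y) + y = t *: th + (1 - t) *: y.
  by rewrite scalerBr scalerBl scale1r -addrA [- _ + y]addrC.
have -> : h y + t * (h th - h y) = t * h th + (1 - t) * h y by ring.
by have := ch (Itv01 t0 t1) th y; rewrite !inE; exact.
Qed.

(* Only [t > 0] is controlled, so the two-sided limit defining ['D_v h y] is
   restricted to a right limit. *)
Lemma derive_le h y v (a b : R) : differentiable h y ->
  (forall t, 0 < t < 1 -> h (t *: v + y) - h y <= t * a + t ^+ 2 * b) ->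
  'D_v h y <= a.
Proof.
move=> dh hle; have dv : derivable h y v by exact: diff_derivable.
have cvgb : (fun t => a + t * b) @ 0^'+ --> a.
  rewrite -[X in _ --> X](addr0 a) -[X in a + X](mul0r b).
  apply: cvgD; first exact: cvg_cst.
  apply: cvgM; last exact: cvg_cst.
  by apply: cvg_at_right_filter; exact: cvg_id.
apply: (ler_cvg_to _ cvgb).
  exact: cvg_dnbhs_at_right dv.
near=> t.
have t01 : 0 < t < 1.
  apply/andP; split; near: t; first exact: nbhs_right_gt.
  exact: nbhs_right_lt.
have /andP[t0 _] := t01.
rewrite -[_ *: _]/(t^-1 * _) ler_pdivrMl//.
by apply: le_trans (hle _ t01) _; lra.
Unshelve. all: by end_near. Qed.

Lemma derive_dotp_grad h y v : differentiable h y ->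
  'D_v h y = dotp (grad h y) v.
Proof.
move=> dh; rewrite deriveE// {1}(row_sum_delta v) linear_sum.
apply: eq_bigr => i _; rewrite linearZ/= mxE deriveE//.
by rewrite mulrC.
Qed.

(** Convexity bounds every difference quotient along the segment by [h th - h y], so [derive_le]
    applies without a quadratic term. *)
Lemma convex_grad_ge h y th : convex_function Y h -> differentiable h y ->
  Y y -> Y th -> dotp (grad h y) (th - y) <= h th - h y.
Proof.
move=> ch dh Yy Yth; rewrite -derive_dotp_grad//.
apply: (@derive_le _ _ _ _ 0) => // t /andP[t0 t1].
have /(_ t) := convex_function_segment ch Yy Yth.
by rewrite (ltW t0) (ltW t1) => /(_ isT); lra.
Qed.

(** Along the segment from [y] to [th] the proximal term is of order [t ^+ 2], so it disappears from
    the first-order condition at [y]. *)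
Lemma prox_fixed_normal_cone h y (c : R) : convex_set Y -> differentiable h y ->
  Y y -> (forall th, Y th -> h y <= h th + c * dotp (th - y) (th - y)) ->
  normal_cone Y y (- grad h y).
Proof.
move=> cY dh Yy hy; split=> // th Yth; rewrite dotpNl -derive_dotp_grad//.
rewrite -deriveN; last exact: diff_derivable.
apply: (@derive_le _ _ _ _ (c * dotp (th - y) (th - y))).
  exact: differentiableN.
move=> t /andP[t0 t1].
have Yt : Y (t *: (th - y) + y).
  by apply: convex_set_segment; rewrite ?(ltW t0) ?(ltW t1).
by have := hy _ Yt; rewrite addrK dotpZl dotpZr opprfctE; lra.
Qed.

Lemma continuous_dotp_self y :
  continuous (fun th : 'rV[R]_m => dotp (th - y) (th - y)).
Proof.
rewrite /dotp; apply: continuous_big => [|i _ th]; first exact: add_continuous.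
have coordB : {for th, continuous (fun v : 'rV[R]_m => (v - y) 0 i)}.
  rewrite (_ : (fun v : 'rV[R]_m => _) = (fun v => v 0 i - y 0 i)).
    by apply: continuousB; [exact: coord_continuous|exact: cst_continuous].
  by apply/funext => v; rewrite !mxE.
exact: continuousM.
Qed.

Lemma prox_exists h y (c : R) : 0 < c -> closed Y -> convex_function Y h ->
  (forall th, Y th -> differentiable h th) -> Y y ->
  exists2 th, Y th & forall th', Y th' ->
    h th + c * dotp (th - y) (th - y) <= h th' + c * dotp (th' - y) (th' - y).
Proof.
move=> c0 clY ch dh Yy.
pose psi th := h th + c * dotp (th - y) (th - y).
pose M := enorm (grad h y) / c.
(* A box, being a product of segments, is compact coordinate by coordinate; its half-width [M] is
   the Euclidean bound on the sublevel set through [y]. *)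
pose box : set 'rV[R]_m :=
  [set v | forall i, v 0 i \in `[y 0 i - M, y 0 i + M]].
have M0 : 0 <= M by rewrite divr_ge0 ?sqrtr_ge0 ?ltW.
have boxy : box y by move=> i; rewrite in_itv/= gerBl lerDl M0.
have psiy : psi y = h y by rewrite /psi subrr dotp0l mulr0 addr0.
(* By the gradient inequality, [psi th <= psi y] forces
   [c |th - y|^2 <= - <grad h y, th - y>]; expanding
   [|grad h y + c (th - y)|^2 >= 0] then gives [c |th - y| <= |grad h y|]. *)
have sublevel_box th : Y th -> psi th <= psi y -> box th.
  move=> Yth; rewrite psiy => psile i; rewrite in_itv/=.
  set w := th - y; set d := grad h y.
  have dw : dotp d w <= h th - h y.
    exact: (convex_grad_ge ch (dh _ Yy) Yy Yth).
  have sq_ge0 := dotpp_ge0 (d + c *: w).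
  rewrite dotpp_addZ in sq_ge0.
  have le_cw : c * dotp w w <= - dotp d w.
    by rewrite /psi -/w in psile; lra.
  have dd : (c * w 0 i) ^+ 2 <= enorm d ^+ 2.
    rewrite enorm_sqr exprMn.
    have /(ler_wpM2l (sqr_ge0 c))/le_trans := coord_sqr_le_dotpp w i; apply.
    by have := ler_wpM2l (ltW c0) le_cw; lra.
  have : `|w 0 i| <= M.
    rewrite /M ler_pdivlMr// mulrC -[X in X * _](gtr0_norm c0) -normrM.
    by rewrite -(ler_pXn2r (n := 2)) ?nnegrE ?sqrtr_ge0// real_normK ?num_real.
  by rewrite /w !mxE ler_norml; lra.
have [|||th] := @EVT_min_rV R m psi (Y `&` box).
- by exists y.
- rewrite setIC; apply: compact_closedI => //.
  apply: (@rV_compact R m (fun i => `[y 0 i - M, y 0 i + M]%classic)) => i.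
  exact: segment_compact.
- apply: continuous_in_subspaceT => th; rewrite inE => -[Yth _].
  apply: (@continuousD _ _ _ h (fun v => c * dotp (v - y) (v - y))).
    exact: differentiable_continuous (dh _ Yth).
  by apply: continuousM; [exact: cst_continuous|exact: continuous_dotp_self].
rewrite inE => -[Yth _] thmin; exists th => // th' Yth'; rewrite -!/(psi _).
have thy : psi th <= psi y by apply: thmin; rewrite inE.
(* Points of [Y] with a value above [psi y] cannot beat [th]; all the others lie in the box. *)
have [le'|/ltW/(le_trans thy)//] := leP (psi th') (psi y).
by apply: thmin; rewrite inE; split=> //; exact: sublevel_box.
Qed.

End Segment.

(** * The scalar concave problem for one multiplier coordinate *)

Section DualStep.
Variables (R : realType) (gamma : R).
Implicit Types a z u : R.

Let phi a z u := u * a - (2 * gamma)^-1 * (u - z) ^+ 2.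

(** With [s = z + gamma * a], completing the square gives [phi a z u = - c * (u - s) ^+ 2] plus a
    constant, so the maximizer over the half-line is the projection of [s]. *)
Lemma dual_step_max a z u : 0 < gamma -> 0 <= u ->
  phi a z u <= phi a z (Num.max 0 (z + gamma * a)).
Proof.
move=> gamma_gt0 u0; rewrite /phi; set c := (2 * gamma)^-1.
have c0 : 0 < c by rewrite invr_gt0 mulr_gt0.
set s := z + gamma * a.
have aE : a = 2 * c * (s - z).
  by rewrite /c /s; field; rewrite gt_eqF.
rewrite {}aE; have [s0|s0] := leP 0 s; rewrite -subr_ge0.
  rewrite (_ : _ - _ = c * (u - s) ^+ 2); last by ring.
  by rewrite mulr_ge0 ?(ltW c0) ?sqr_ge0.
rewrite (_ : _ - _ = c * (u ^+ 2 + 2 * (u * - s))); last by ring.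
have us : 0 <= u * - s by rewrite mulr_ge0// oppr_ge0 ltW.
by rewrite mulr_ge0 ?(ltW c0)// addr_ge0 ?sqr_ge0// mulr_ge0.
Qed.

(** If [s = z + gamma * a] is nonnegative, moving from [z] to [s] gains [gamma / 2 * a ^+ 2], which
    forces [a = 0]. Otherwise [a < 0], and comparing with the value at [0] forces [z = 0]. *)
Lemma dual_step_fixed a z : 0 < gamma -> 0 <= z ->
  phi a z (Num.max 0 (z + gamma * a)) <= phi a z z -> a <= 0 /\ z * a = 0.
Proof.
move=> gamma_gt0 z0; rewrite /phi subrr expr0n mulr0 subr0.
have [s0|s0] := leP 0 (z + gamma * a).
  rewrite [z + _ - z]addrAC subrr add0r exprMn.
  have -> : (z + gamma * a) * a - (2 * gamma)^-1 * (gamma ^+ 2 * a ^+ 2) =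
      z * a + gamma / 2 * a ^+ 2.
    by field; rewrite gt_eqF.
  rewrite gerDl pmulr_rle0 ?divr_gt0// => a2.
  have /eqP : a ^+ 2 = 0 by apply/eqP; rewrite eq_le a2 sqr_ge0.
  by rewrite sqrf_eq0 => /eqP ->; rewrite mulr0.
rewrite mul0r !add0r sqrrN => le_za.
have a0 : a < 0 by rewrite -(pmulr_rlt0 _ gamma_gt0); lra.
split; first exact: ltW.
have z2 : 0 <= z * (z + 2 * gamma * a).
  have := ler_wpM2l (mulr_ge0 (ler0n R 2) (ltW gamma_gt0)) le_za.
  have -> : 2 * gamma * - ((2 * gamma)^-1 * z ^+ 2) = - z ^+ 2.
    by field; rewrite gt_eqF.
  lra.
have za0 : z + 2 * gamma * a < 0 by lra.
have z_le0 : z <= 0 by rewrite -(nmulr_lge0 _ za0).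
by rewrite (le_anti (_ : z <= 0 <= z)) ?mul0r// z_le0.
Qed.

End DualStep.

(** * The Lagrangian, and the splitting of the gap objective *)

Section GapFunction.
Local Open Scope convex_scope.
Variables (R : realType) (n m p : nat) (Y : set 'rV[R]_m).
Variables (f : 'rV[R]_n -> 'rV[R]_m -> R).
Variables (g : 'rV[R]_n -> 'rV[R]_m -> 'rV[R]_p).
Implicit Types (x : 'rV[R]_n) (y th : 'rV[R]_m) (z l : 'rV[R]_p).

Lemma lagrangian_convex x z : nonneg_orthant z -> convex_function Y (f x) ->
  (forall i, convex_function Y (fun y => g x y 0 i)) ->
  convex_function Y (lagrangian f g x ^~ z).
Proof.
move=> z0 cf cg t y th Yy Yth; rewrite /lagrangian /dotp.
have -> : (f x y + \sum_(i < p) z 0 i * g x y 0 i : R^o) <| t |>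
    (f x th + \sum_(i < p) z 0 i * g x th 0 i : R^o) =
  ((f x y : R^o) <| t |> (f x th : R^o)) +
   \sum_(i < p) z 0 i * ((g x y 0 i : R^o) <| t |> (g x th 0 i : R^o)).
  rewrite !convRE !mulrDr addrACA !mulr_sumr -big_split/=; congr (_ + _).
  by apply: eq_bigr => i _; rewrite convRE; ring.
apply: lerD; first exact: cf.
by apply: ler_sum => i _; apply: ler_wpM2l; [exact: z0|exact: cg].
Qed.

(** Identifies the stationarity condition in [multipliers] with [- grad L y] being normal to [Y],
    where [L] is the Lagrangian at fixed [x] and [z]. *)
Lemma differentiable_grad_lagrangian x y z : differentiable (f x) y ->
  (forall i, differentiable (fun y => g x y 0 i) y) ->
  differentiable (lagrangian f g x ^~ z) y /\
  grad (lagrangian f g x ^~ z) y =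
  grad (f x) y + \sum_(i < p) z 0 i *: grad (fun y' => g x y' 0 i) y.
Proof.
move=> df dg.
have -> : lagrangian f g x ^~ z =
    f x + \sum_(i < p) (z 0 i \*: (fun y' => g x y' 0 i)).
  by apply/funext => y'; rewrite /lagrangian /dotp fctE/= fct_sumE.
split.
  apply: differentiableD => //; apply: differentiable_sum => i.
  exact: differentiableZ.
apply/rowP => j; rewrite !mxE summxE deriveD; first last.
- by apply: derivable_sum => i; apply: derivableZ; exact: diff_derivable.
- exact: diff_derivable.
rewrite derive_sum; last first.
  by move=> i; apply: derivableZ; exact: diff_derivable.
congr (_ + _); apply: eq_bigr => i _; rewrite !mxE deriveZ//.
exact: diff_derivable.
Qed.

(** Separates [th] from [l], and the coordinates of [l] from each other, so that each can be
    optimized alone. *)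
Lemma gap_objectiveE gamma1 gamma2 x y z th l :
  gap_objective f g gamma1 gamma2 x y z th l =
  f x y - (lagrangian f g x th z
           + (2 * gamma1)^-1 * dotp (th - y) (th - y))
  + \sum_(i < p) (l 0 i * g x y 0 i - (2 * gamma2)^-1 * (l 0 i - z 0 i) ^+ 2).
Proof.
rewrite /gap_objective !enorm_sqr {1}/lagrangian sumrB -mulr_sumr.
have -> : \sum_(i < p) (l 0 i - z 0 i) ^+ 2 = dotp (l - z) (l - z).
  by apply: eq_bigr => i _; rewrite !mxE expr2.
by rewrite -/(dotp l (g x y)); ring.
Qed.

End GapFunction.

Theorem lemma2p1 (R : realType) (n m p : nat)
    (X : set 'rV[R]_n) (Y : set 'rV[R]_m)
    (f : 'rV[R]_n -> 'rV[R]_m -> R) (g : 'rV[R]_n -> 'rV[R]_m -> 'rV[R]_p)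
    (gamma1 gamma2 : R)
    (Xclosed : closed X) (Xconvex : convex_set X)
    (Yclosed : closed Y) (Yconvex : convex_set Y)
    (fC1 : C1_on (fun q => f q.1 q.2) (X `*` Y))
    (gC1 : C1_on (fun q => g q.1 q.2) (X `*` Y))
    (fconvex : forall x, X x -> convex_function Y (f x))
    (gconvex : forall x, X x -> forall i : 'I_p,
      convex_function Y (fun y => g x y 0 i))
    (gamma1_gt0 : 0 < gamma1) (gamma2_gt0 : 0 < gamma2) :
  forall x y z, X x -> Y y -> nonneg_orthant z ->
    [/\ exists th l, [/\ Y th, nonneg_orthant l &
          gap Y f g gamma1 gamma2 x y z =
          (gap_objective f g gamma1 gamma2 x y z th l)%:E],
        (0 <= gap Y f g gamma1 gamma2 x y z)%E &
        (gap Y f g gamma1 gamma2 x y z <= 0)%E <->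
        solutions Y f g x y /\ multipliers Y f g x y z].
Proof.
move=> x y z Xx Yy z0.
set L := lagrangian f g x ^~ z.
set c := (2 * gamma1)^-1; have c0 : 0 < c by rewrite invr_gt0 mulr_gt0.
(* Composing with this slice turns joint differentiability into differentiability in the second
   variable. *)
have dx (th : 'rV[R]_m) : differentiable (fun th' : 'rV[R]_m => (x, th')) th.
  apply: differentiable_pair; first exact: differentiable_cst.
  exact: ex_diff.
have df th : Y th -> differentiable (f x) th.
  move=> Yth; case: fC1 => O [_ sub /(_ (x, th) (sub (x, th) (conj Xx Yth)))[]].
  by move=> dF _; exact: (differentiable_comp (dx th) dF).
have dg th : Y th -> forall i, differentiable (fun th => g x th 0 i) th.
  move=> Yth i.
  case: gC1 => O [_ sub /(_ (x, th) (sub (x, th) (conj Xx Yth)))[]].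
  move=> dF _; apply: (@differentiable_comp _ _ _ _ (g x) (fun v => v 0 i)).
    exact: (differentiable_comp (dx th) dF).
  exact: differentiable_coord.
have dL th : Y th -> differentiable L th.
  by move=> Yth; case: (differentiable_grad_lagrangian z (df _ Yth) (dg _ Yth)).
have [_ gradL] := differentiable_grad_lagrangian z (df _ Yy) (dg _ Yy).
have cvxL : convex_function Y L.
  by apply: lagrangian_convex => // [|i]; [exact: fconvex|exact: gconvex].
have [th Yth thP] := prox_exists c0 Yclosed cvxL dL Yy.
pose l : 'rV[R]_p := \row_i Num.max 0 (z 0 i + gamma2 * g x y 0 i).
have l0 : nonneg_orthant l by move=> i; rewrite mxE le_max lexx.
have objective_max th' l' : Y th' -> nonneg_orthant l' ->
    gap_objective f g gamma1 gamma2 x y z th' l' <=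
    gap_objective f g gamma1 gamma2 x y z th l.
  move=> Yth' l'0; rewrite !gap_objectiveE; apply: lerD.
    by rewrite lerD2l lerN2; exact: thP.
  by apply: ler_sum => i _; rewrite mxE; exact: dual_step_max.
have gapE : gap Y f g gamma1 gamma2 x y z =
    (gap_objective f g gamma1 gamma2 x y z th l)%:E.
  apply/eqP; rewrite eq_le; apply/andP; split.
    by apply: ge_ereal_sup => _ [[th' l'] [/= Yth' l'0] <-];
      rewrite lee_fin; exact: objective_max.
  by apply: ereal_sup_ubound; exists (th, l).
have objective_diag : gap_objective f g gamma1 gamma2 x y z y z = 0.
  by rewrite /gap_objective !subrr !enorm_sqr !dotp0l !mulr0 !subr0 subrr.
split; first by exists th, l.
  by rewrite gapE lee_fin -objective_diag; exact: objective_max.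
rewrite gapE lee_fin; split=> [gap_le0|[[[_ gy_le0] _] [_ [v vN vE] zg]]].
  have objective_le0 th' l' : Y th' -> nonneg_orthant l' ->
      gap_objective f g gamma1 gamma2 x y z th' l' <= 0.
    by move=> Yth' l'0; exact: le_trans (objective_max _ _ Yth' l'0) gap_le0.
  have normal : normal_cone Y y (- grad L y).
    apply: (prox_fixed_normal_cone (c := c)) => // [|th' Yth']; first exact: dL.
    have := objective_le0 _ _ Yth' z0.
    by rewrite /gap_objective subrr !enorm_sqr dotp0l -/c /L; lra.
  have Lmin th' : Y th' -> L y <= L th'.
    move=> Yth'; have [_ /(_ _ Yth')] := normal.
    by have := convex_grad_ge cvxL (dL _ Yy) Yy Yth'; rewrite dotpNl; lra.
  (* Compare [(y, l)] with [(y, z)]: every coordinate gain is nonnegative by [dual_step_max] and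
     their sum is nonpositive, so no coordinate gains anything. *)
  have compl i : g x y 0 i <= 0 /\ z 0 i * g x y 0 i = 0.
    apply: (dual_step_fixed gamma2_gt0 (z0 i)).
    have := objective_le0 _ _ Yy l0.
    rewrite -[X in _ <= X -> _]objective_diag !gap_objectiveE lerD2l.
    rewrite -subr_le0 -sumrB (bigD1 i)//= [l 0 i]mxE => sum_le0.
    rewrite -subr_le0; apply: le_trans sum_le0; rewrite lerDl sumr_ge0// => j _.
    by rewrite subr_ge0 mxE; exact: dual_step_max.
  have zg : dotp z (g x y) = 0 by apply: big1 => i _; have [] := compl i.
  split.
    split; first by split=> // i; have [] := compl i.
    (* Weak duality: [f x y = L y <= L y' <= f x y'], by complementarity at [y] and feasibility of
       [y']. *)
    move=> y' [Yy' gy'_le0]; have := Lmin _ Yy'.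
    rewrite /L /lagrangian zg addr0 => /le_trans; apply.
    by rewrite gerDl; apply: sumr_le0 => i _; exact: mulr_ge0_le0.
  split=> //; exists (- grad L y) => //.
  by rewrite gradL subrr.
(* Writing [0] as the objective at [(y, z)] allows a comparison of the primal and dual parts
   separately. *)
rewrite -[leRHS]objective_diag !gap_objectiveE; apply: lerD.
  rewrite lerD2l lerN2 subrr dotp0l mulr0 addr0.
  have Lth : L y <= L th.
    have [_ /(_ _ Yth)] := vN.
    have -> : v = - grad L y by apply/eqP; rewrite -addr_eq0 gradL addrC -vE.
    by have := convex_grad_ge cvxL (dL _ Yy) Yy Yth; rewrite dotpNl; lra.
  by rewrite ler_wpDr// mulr_ge0 ?(ltW c0) ?dotpp_ge0.
have -> : \sum_(i < p) (z 0 i * g x y 0 i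
    - (2 * gamma2)^-1 * (z 0 i - z 0 i) ^+ 2) = 0.
  rewrite -[RHS]zg; apply: eq_bigr => i _.
  by rewrite subrr expr0n mulr0 subr0.
apply: sumr_le0 => i _; rewrite subr_le0.
apply: (@le_trans _ _ 0); first exact: mulr_ge0_le0.
by rewrite mulr_ge0 ?sqr_ge0// invr_ge0 mulr_ge0// ltW.
Qed.
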